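(* Let $A_1A_2B_1B_2D_2D_1$ be a right-angled hexagon in the hyperbolic plane. Let $a_*$ be the common perpendicular to the lines $B_2D_2$ and $A_1A_2$, and let $c_*$ be the common perpendicular to the lines $B_2D_2$ and $B_1D_1$. Let $A_*, C_*$ be the intersection points of $a_*, c_*$, respectively, with $B_2D_2$. Then the midpoint of $\overline{A_*C_*}$ is the midpoint of $\overline{B_2D_2}$.
   Context: A right-angled hexagon is a hexagon in the hyperbolic plane (a simple polygon whose vertices are listed in cyclic order) with six right angles. The midpoint of a degenerate segment (equal endpoints) is that endpoint. *)

(* Defs.v *)
From HB Require Import structures.
From mathcomp Require Import all_boot all_order all_algebra.
From mathcomp Require Import boolp classical_sets reals exp trigo.

Set Implicit Arguments.
Unset Strict Implicit.
Unset Printing Implicit Defensive.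

Import Order.TTheory GRing.Theory Num.Theory.
Local Open Scope classical_set_scope.
Local Open Scope ring_scope.

(* The hyperbolic plane is modelled by the upper sheet of the hyperboloid     *)
(* <x, x> = -1 in Minkowski space R^{1,2}, with its metric of curvature -1.   *)

Definition mink (R : realType) (x y : 'rV[R]_3) : R :=
  - (x 0 0 * y 0 0) + x 0 1 * y 0 1 + x 0 2%:R * y 0 2%:R.

Record hpoint (R : realType) := HPoint {
  hvec :> 'rV[R]_3;
  _ : (mink hvec hvec == -1) && (0 < hvec 0 0)
}.

HB.instance Definition _ (R : realType) := [isSub for @hvec R].

Definition arcosh (R : realType) (x : R) : R := ln (x + Num.sqrt (x ^+ 2 - 1)).

Definition hdist (R : realType) (P Q : hpoint R) : R := arcosh (- mink P Q).

(* Geodesics are the sections of the hyperboloid by linear planes; this is    *)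
(* a line only when P <> Q.                                                   *)
Definition hline (R : realType) (P Q : hpoint R) : set (hpoint R) :=
  [set X | exists s t : R, hvec X = s *: hvec P + t *: hvec Q].

Definition is_hline (R : realType) (l : set (hpoint R)) : Prop :=
  exists P Q : hpoint R, P <> Q /\ l = hline P Q.

(* The closed geodesic segment, cut out by the convex cone over P and Q; it   *)
(* is [set P] when P = Q.                                                     *)
Definition hsegment (R : realType) (P Q : hpoint R) : set (hpoint R) :=
  [set X | exists s t : R,
     [/\ 0 <= s, 0 <= t & hvec X = s *: hvec P + t *: hvec Q]].

Definition is_midpoint (R : realType) (P Q M : hpoint R) : Prop :=
  hsegment P Q M /\ hdist P M = hdist M Q.

(* The orthogonal projection of P to the tangent space at Q, a positive       *)
(* multiple of the initial velocity of the geodesic from Q to P if P <> Q.    *)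
Definition htangent (R : realType) (Q P : hpoint R) : 'rV[R]_3 :=
  hvec P + mink P Q *: hvec Q.

(* The angle PQS in [0, pi]; its value is meaningless when P = Q or S = Q.    *)
Definition hangle (R : realType) (P Q S : hpoint R) : R :=
  let u := htangent Q P in let v := htangent Q S in
  acos (mink u v / (Num.sqrt (mink u u) * Num.sqrt (mink v v))).

Definition perpendicular (R : realType) (l m : set (hpoint R)) : Prop :=
  exists P : hpoint R, [/\ l P, m P &
    forall X Y : hpoint R, l X -> m Y -> X <> P -> Y <> P ->
      hangle X P Y = pi / 2].

Definition common_perpendicular (R : realType) (l m p : set (hpoint R)) : Prop :=
  [/\ is_hline p, perpendicular p l & perpendicular p m].

(* A polygon is the cyclic sequence v of its vertices: ordS i and ord_pred i  *)
(* are the indices following and preceding i modulo n.                        *)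
Definition side (R : realType) (n : nat) (v : n.-tuple (hpoint R)) (i : 'I_n) :
    set (hpoint R) :=
  hsegment (tnth v i) (tnth v (ordS i)).

(* Distinct sides meet only if they are consecutive, and then only at their   *)
(* common vertex.                                                             *)
Definition simple_polygon (R : realType) (n : nat) (v : n.-tuple (hpoint R)) :
    Prop :=
  [/\ (3 <= n)%N, injective (tnth v) &
    forall (i j : 'I_n) (X : hpoint R), i <> j -> side v i X -> side v j X ->
      (j = ordS i /\ X = tnth v j) \/ (i = ordS j /\ X = tnth v i)].

(* No reflex angle 3 pi / 2 can be hidden in the unoriented angles: the       *)
(* interior angles of a hyperbolic hexagon add up to less than 4 pi.          *)
Definition right_angled_hexagon (R : realType) (v : 6.-tuple (hpoint R)) :
    Prop :=
  simple_polygon v /\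
  forall i : 'I_6,
    hangle (tnth v (ord_pred i)) (tnth v i) (tnth v (ordS i)) = pi / 2.

(* Main.v *)
Require Import Defs.
From mathcomp Require Import all_boot all_order all_algebra.
From mathcomp Require Import boolp classical_sets reals exp trigo.
From mathcomp Require Import ring lra.

(* Let n be a normal of the plane of B2D2. The right
   angles at B2 and D2 give B1 = -<B1,B2> B2 + p n and D1 = -<D1,D2> D2 + q n
   with p, q nonzero. The common perpendiculars make n + r A normal to A1A2 and
   n + r' C normal to B1D1 for some scalars r, r'. Taking products of the latter
   with B1 and D1 gives
     <C,B2> : <C,D2> = p/<B1,B2> : q/<D1,D2>,
   while the four remaining right angles give the inverse ratio
     <A,B2> : <A,D2> = <B1,B2>/p : <D1,D2>/q.
   A point of the line is determined by this ratio, so C is the mirror image of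
   A under the reflection exchanging B2 and D2; hence A + C and B2 + D2 are
   proportional, and the midpoint of a segment is the normalized sum of its
   endpoints. *)

Import Order.TTheory GRing.Theory Num.Theory.
Local Open Scope ring_scope.

Section Minkowski.
Set Implicit Arguments.
Unset Strict Implicit.
Variable R : realType.
Implicit Types (x y z u v : 'rV[R]_3) (s t : R).
Implicit Types (P Q S T V X Y M A C F : hpoint R).

(** * Bilinear algebra of the Minkowski form *)

Lemma row3P x y :
  x 0 0 = y 0 0 -> x 0 1 = y 0 1 -> x 0 2%:R = y 0 2%:R -> x = y.
Proof.
move=> e0 e1 e2; apply/rowP; case=> [[|[|[|//]]] lti] /=.
- by have -> : Ordinal lti = 0 by apply/val_inj.
- by have -> : Ordinal lti = 1 by apply/val_inj.
- by have -> : Ordinal lti = 2%:R by apply/val_inj.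
Qed.

Lemma minkC x y : mink x y = mink y x.
Proof. by rewrite /mink; ring. Qed.

Lemma minkDl x y z : mink (x + y) z = mink x z + mink y z.
Proof. by rewrite /mink !mxE; ring. Qed.

Lemma minkDr x y z : mink z (x + y) = mink z x + mink z y.
Proof. by rewrite /mink !mxE; ring. Qed.

Lemma minkZl s x y : mink (s *: x) y = s * mink x y.
Proof. by rewrite /mink !mxE; ring. Qed.

Lemma minkZr s x y : mink x (s *: y) = s * mink x y.
Proof. by rewrite /mink !mxE; ring. Qed.

Definition minkE := (minkDl, minkDr, minkZl, minkZr).

Lemma hpoint_norm P : mink P P = -1.
Proof. by case: P => x /= /andP[/eqP]. Qed.

Lemma hpoint_gt0 P : 0 < hvec P 0 0.
Proof. by case: P => x /= /andP[]. Qed.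

Lemma hvec_inj : injective (@hvec R).
Proof. exact: val_inj. Qed.

(** * Inequalities for the form, and right angles *)

(** Reversed Cauchy-Schwarz inequality: with p0^2 = 1 + p1^2 + p2^2, and likewise for q, Lagrange's
    identity writes the gap as a sum of three squares, which vanish together only if the points
    coincide. *)
Lemma mink_gap P Q : mink P Q <= -1 /\ (mink P Q = -1 -> P = Q).
Proof.
have := hpoint_norm P; have := hpoint_norm Q.
have := hpoint_gt0 P; have := hpoint_gt0 Q; rewrite /mink.
set p0 := hvec P 0 0; set p1 := hvec P 0 1; set p2 := hvec P 0 2%:R.
set q0 := hvec Q 0 0; set q1 := hvec Q 0 1; set q2 := hvec Q 0 2%:R.
move=> q0_gt0 p0_gt0 nQ nP.
have gap : (p0 * q0) ^+ 2 - (1 + p1 * q1 + p2 * q2) ^+ 2 =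
    (p1 - q1) ^+ 2 + (p2 - q2) ^+ 2 + (p1 * q2 - p2 * q1) ^+ 2.
  have -> : (p0 * q0) ^+ 2 = (1 + p1 ^+ 2 + p2 ^+ 2) * (1 + q1 ^+ 2 + q2 ^+ 2).
    by rewrite exprMn; congr (_ * _); lra.
  by ring.
have pq_gt0 : 0 < p0 * q0 by rewrite mulr_gt0.
have s1 := sqr_ge0 (p1 - q1); have s2 := sqr_ge0 (p2 - q2).
have s3 := sqr_ge0 (p1 * q2 - p2 * q1).
split; first by nra.
move=> e.
have e' : p0 * q0 = 1 + p1 * q1 + p2 * q2 by lra.
rewrite e' subrr in gap.
have e1 : p1 = q1 by apply/eqP; rewrite -subr_eq0 -sqrf_eq0; apply/eqP; lra.
have e2 : p2 = q2 by apply/eqP; rewrite -subr_eq0 -sqrf_eq0; apply/eqP; lra.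
apply/hvec_inj/row3P => //.
apply/eqP; rewrite -(@eqrXn2 _ 2) ?ltW //; apply/eqP.
by rewrite -/p0 -/q0; rewrite e1 e2 in nP; lra.
Qed.

Lemma mink_le P Q : mink P Q <= -1.
Proof. by case: (mink_gap P Q). Qed.

Lemma mink_lt0 P Q : mink P Q < 0.
Proof. by have := mink_le P Q; lra. Qed.

Lemma mink_lt P Q : P <> Q -> mink P Q < -1.
Proof.
move=> neq; rewrite lt_neqAle mink_le andbT.
by apply/eqP => e; apply: neq; case: (mink_gap P Q) => _; apply.
Qed.

Lemma mink_sqr_gt1 P Q : P <> Q -> 1 < mink P Q ^+ 2.
Proof. by move=> /mink_lt; nra. Qed.

(** The form is positive definite on the tangent plane at [Q]: eliminating the time coordinates
    turns the Gram determinant of [u], [v] into a perfect square. *)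
Lemma tangent_cauchy_schwarz Q u v :
  mink u Q = 0 -> mink v Q = 0 -> mink u v ^+ 2 <= mink u u * mink v v.
Proof.
have := hpoint_norm Q; have := hpoint_gt0 Q; rewrite /mink.
set q0 := hvec Q 0 0; set q1 := hvec Q 0 1; set q2 := hvec Q 0 2%:R.
set u0 := u 0 0; set u1 := u 0 1; set u2 := u 0 2%:R.
set v0 := v 0 0; set v1 := v 0 1; set v2 := v 0 2%:R.
move=> q0_gt0 nQ uQ vQ.
have {}uQ : u0 = (u1 * q1 + u2 * q2) / q0.
  by apply: (mulIf (lt0r_neq0 q0_gt0)); rewrite divfK ?gt_eqF //; lra.
have {}vQ : v0 = (v1 * q1 + v2 * q2) / q0.
  by apply: (mulIf (lt0r_neq0 q0_gt0)); rewrite divfK ?gt_eqF //; lra.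
rewrite -subr_ge0.
suff -> : (- (u0 * u0) + u1 * u1 + u2 * u2) * (- (v0 * v0) + v1 * v1 + v2 * v2)
    - (- (u0 * v0) + u1 * v1 + u2 * v2) ^+ 2 =
    ((u1 * v2 - u2 * v1) / q0) ^+ 2 by exact: sqr_ge0.
transitivity ((u1 * v2 - u2 * v1) ^+ 2 * (q0 ^+ 2 - q1 ^+ 2 - q2 ^+ 2)
   / q0 ^+ 2).
  by rewrite uQ vQ; field; rewrite gt_eqF.
have -> : q0 ^+ 2 - q1 ^+ 2 - q2 ^+ 2 = 1 by lra.
by field; rewrite gt_eqF.
Qed.

(** Hyperbolic Pythagoras, as [- mink] is the cosh of the distance: the tangent vectors at [Q] have
    product zero. *)
Lemma right_angle P Q S :
  hangle P Q S = pi / 2 -> mink P S = - (mink P Q * mink Q S).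
Proof.
rewrite /hangle.
set u := htangent Q P; set v := htangent Q S.
have nQ := hpoint_norm Q.
have uQ : mink u Q = 0 by rewrite !minkE nQ; ring.
have vQ : mink v Q = 0 by rewrite !minkE nQ; ring.
have uv : mink u v = mink P S + mink P Q * mink Q S.
  by rewrite !minkE nQ (minkC S Q); ring.
have uu_ge0 : 0 <= mink u u.
  by rewrite !minkE nQ !hpoint_norm (minkC Q P); have := mink_le P Q; nra.
have vv_ge0 : 0 <= mink v v.
  by rewrite !minkE nQ !hpoint_norm (minkC Q S); have := mink_le S Q; nra.
have cs := tangent_cauchy_schwarz uQ vQ.
set d := Num.sqrt _ * _; move=> acosE.
have dE : mink u u * mink v v = d ^+ 2 by rewrite exprMn !sqr_sqrtr.
rewrite dE in cs.
suff : mink u v = 0 by rewrite uv; lra.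
(* For [d] = 0 the quotient is 0 by convention and the angle carries no information; Cauchy-Schwarz
   gives the claim instead. *)
have [d0|d_neq0] := eqVneq d 0.
  by apply/eqP; rewrite -sqrf_eq0 eq_le sqr_ge0 andbT (le_trans cs)// d0 expr0n.
have bound : mink u v / d \in `[-1, 1].
  have : (mink u v / d) ^+ 2 <= 1.
    by rewrite expr_div_n ler_pdivrMr ?mul1r // lt0r sqrf_eq0 d_neq0 sqr_ge0.
  by rewrite in_itv /=; nra.
have : mink u v / d = 0 by rewrite -[LHS]acosK // acosE cos_pihalf.
by move/eqP; rewrite mulf_eq0 invr_eq0 (negbTE d_neq0) orbF => /eqP.
Qed.

(** * Normals of lines *)

(** The Lorentzian cross product: the Euclidean one with its time coordinate negated, so that
    [mink (pole x y) z] is det(x, y, z). *)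
Definition pole x y : 'rV[R]_3 := \row_i
  [:: x 0 2%:R * y 0 1 - x 0 1 * y 0 2%:R;
      x 0 2%:R * y 0 0 - x 0 0 * y 0 2%:R;
      x 0 0 * y 0 1 - x 0 1 * y 0 0]`_i.

Lemma pole_orthol x y : mink (pole x y) x = 0.
Proof. by rewrite /mink !mxE /=; ring. Qed.

Lemma pole_orthor x y : mink (pole x y) y = 0.
Proof. by rewrite /mink !mxE /=; ring. Qed.

Lemma pole_norm x y :
  mink (pole x y) (pole x y) = mink x y ^+ 2 - mink x x * mink y y.
Proof. by rewrite /mink !mxE /=; ring. Qed.

(** Cramer's rule for [u] in the frame [x], [y], [pole x y], with the denominator cleared. *)
Lemma pole_frame x y u :
  mink (pole x y) (pole x y) *: u =
  (mink x y * mink u y - mink y y * mink u x) *: x +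
  (mink x y * mink u x - mink x x * mink u y) *: y +
  mink u (pole x y) *: pole x y.
Proof. by apply: row3P; rewrite /mink !mxE /=; ring. Qed.

Lemma pole_norm_gt0 P Q : P <> Q -> 0 < mink (pole P Q) (pole P Q).
Proof. by move=> /mink_sqr_gt1; rewrite pole_norm !hpoint_norm; lra. Qed.

Lemma orthogonal_line P Q u :
  P <> Q -> mink u P = 0 -> mink u Q = 0 -> exists s, u = s *: pole P Q.
Proof.
move=> neq uP uQ; have N_gt0 := pole_norm_gt0 neq.
exists (mink u (pole P Q) / mink (pole P Q) (pole P Q)).
apply: (scalerI (lt0r_neq0 N_gt0)).
rewrite scalerA pole_frame uP uQ !mulr0 subrr !scale0r !add0r.
by rewrite mulrC divfK // gt_eqF.
Qed.

(** * Distances and midpoints *)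

Lemma arcosh_inj (x y : R) : 1 <= x -> 1 <= y -> arcosh x = arcosh y -> x = y.
Proof.
have mono (a b : R) : 1 <= a -> a < b ->
    a + Num.sqrt (a ^+ 2 - 1) < b + Num.sqrt (b ^+ 2 - 1).
  by move=> a1 ab; rewrite ltr_leD // ler_wsqrtr //; nra.
have pos (a : R) : 1 <= a -> a + Num.sqrt (a ^+ 2 - 1) \is Num.pos.
  move=> a1; rewrite posrE ltr_pwDl ?sqrtr_ge0 //; lra.
move=> x1 y1 /ln_inj - /(_ (pos _ x1) (pos _ y1)) e.
have [xy|yx|//] := ltgtP x y.
- by have := mono _ _ x1 xy; rewrite e ltxx.
- by have := mono _ _ y1 yx; rewrite e ltxx.
Qed.

Lemma hdist_inj P Q X Y : hdist P Q = hdist X Y -> mink P Q = mink X Y.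
Proof.
move=> /arcosh_inj e; apply: oppr_inj; apply: e.
- by have := mink_le P Q; lra.
- by have := mink_le X Y; lra.
Qed.

Lemma midpoint_of_sum P Q M s :
  hvec M = s *: (hvec P + hvec Q) -> is_midpoint P Q M.
Proof.
move=> ME.
have s_gt0 : 0 < s.
  have /(congr1 (fun x : 'rV_3 => x 0 0)) := ME; rewrite !mxE => e.
  have := hpoint_gt0 M; rewrite e pmulr_lgt0 //.
  by rewrite addr_gt0 // hpoint_gt0.
split; first by exists s, s; rewrite -scalerDr (ltW s_gt0).
by rewrite /hdist ME !minkE !hpoint_norm; congr arcosh; ring.
Qed.

(** For N = a P + b Q equidistance reads (b - a)(<P,Q> + 1) = 0, so N is proportional to P + Q, also
    when P = Q. The norm -1 and the positive time coordinate then fix the factor. *)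
Lemma midpoint_unique P Q M s :
  hvec M = s *: (hvec P + hvec Q) -> unique (is_midpoint P Q) M.
Proof.
move=> ME; split; first exact: midpoint_of_sum ME.
move=> N [[a [b [a_ge0 b_ge0 NE]]] /hdist_inj].
rewrite NE !minkE !hpoint_norm => dE.
have [t Nt] : exists t, hvec N = t *: (hvec P + hvec Q).
  have [k_eq|k_neq] := eqVneq (mink P Q) (-1).
    have [_ /(_ k_eq) PQ] := mink_gap P Q.
    exists ((a + b) / 2); rewrite NE PQ -scalerDl -mulr2n -scaler_nat scalerA.
    by rewrite divfK // pnatr_eq0.
  exists a; rewrite NE scalerDr; congr (_ + _ *: _).
  have : (b - a) * (mink P Q + 1) = 0 by lra.
  move/eqP; rewrite mulf_eq0 subr_eq0 addr_eq0 (negbTE k_neq) orbF.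
  by move/eqP.
have sum_gt0 : 0 < (hvec P + hvec Q) 0 0 by rewrite mxE addr_gt0 // hpoint_gt0.
have pos r (X : hpoint R) : hvec X = r *: (hvec P + hvec Q) -> 0 < r.
  move=> XE; have := hpoint_gt0 X.
  by rewrite XE [X in 0 < X]mxE pmulr_lgt0.
have normE r (X : hpoint R) : hvec X = r *: (hvec P + hvec Q) ->
    r ^+ 2 * mink (hvec P + hvec Q) (hvec P + hvec Q) = -1.
  by move=> XE; rewrite -(hpoint_norm X) XE minkZl minkZr expr2 mulrA.
apply: hvec_inj; rewrite ME Nt; congr (_ *: _).
apply/eqP; rewrite -(@eqrXn2 _ 2) ?ltW ?(pos _ _ ME) ?(pos _ _ Nt) //.
apply/eqP; have := normE _ _ ME; rewrite -(normE _ _ Nt); apply: mulIf.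
apply: contra_eq_neq (normE _ _ ME) => ->.
by rewrite mulr0 eq_sym oppr_eq0 oner_eq0.
Qed.

Lemma midpoint_exists P Q : exists M s, hvec M = s *: (hvec P + hvec Q).
Proof.
have k := mink_le P Q.
(* Normalizes the sum, since <P+Q, P+Q> = 2 <P,Q> - 2. *)
set s := (Num.sqrt (2 - 2 * mink P Q))^-1.
have s_gt0 : 0 < s by rewrite invr_gt0 sqrtr_gt0; lra.
have sE : s ^+ 2 * (2 - 2 * mink P Q) = 1.
  by rewrite exprVn sqr_sqrtr ?mulVf ?gt_eqF //; lra.
have MP : (mink (s *: (hvec P + hvec Q)) (s *: (hvec P + hvec Q)) == -1) &&
          (0 < (s *: (hvec P + hvec Q)) 0 0).
  apply/andP; split; last by rewrite !mxE mulr_gt0 // addr_gt0 // hpoint_gt0.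
  apply/eqP; rewrite !minkE !hpoint_norm (minkC Q P); lra.
by exists (HPoint MP), s.
Qed.

(** * Perpendicular lines *)

Lemma perpendicular_foot (l m : set (hpoint R)) F :
  perpendicular l m -> l F -> m F ->
  forall X Y, l X -> m Y -> mink X Y = - (mink X F * mink F Y).
Proof.
move=> [P [lP mP right]] lF mF.
have {}right X Y : l X -> m Y -> mink X Y = - (mink X P * mink P Y).
  move=> lX mY; have [->|XP] := pselect (X = P).
    by rewrite hpoint_norm; ring.
  have [->|YP] := pselect (Y = P); first by rewrite hpoint_norm; ring.
  exact/right_angle/right.
(* A common point [F] is the foot: the relation for the pair [F], [F] gives <F,P>^2 = 1. *)
suff -> : F = P by [].
have := right F F lF mF; rewrite hpoint_norm (minkC P F) => e.
by have [//|/mink_sqr_gt1 FP] := pselect (F = P); exfalso; lra.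
Qed.

Lemma hline_l P Q : hline P Q P.
Proof. by exists 1, 0; rewrite scale1r scale0r addr0. Qed.

Lemma hline_r P Q : hline P Q Q.
Proof. by exists 0, 1; rewrite scale1r scale0r add0r. Qed.

(* The plane of a line perpendicular to [P Q] at [A] is spanned by [A] and the
   pole of [P Q], so it contains a normal of [m] of the stated form. *)
Lemma common_perpendicular_pole P Q (m p : set (hpoint R)) A :
  P <> Q -> common_perpendicular (hline P Q) m p -> p A -> hline P Q A ->
  exists s, forall Y, m Y -> mink (pole P Q + s *: hvec A) Y = 0.
Proof.
move=> PQ [[X0 [X1 [X01 pE]]] pPQ [F [pF mF pm]]] pA PQ_A.
have [X pX XA] : exists2 X, p X & X <> A.
  rewrite pE; have [e|X0A] := pselect (X0 = A).
    by exists X1; [exact: hline_r|rewrite -e; exact/nesym].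
  by exists X0; first exact: hline_l.
have footA := perpendicular_foot pPQ pA PQ_A.
have footF : forall Z Y, p Z -> m Y -> mink Z Y = - (mink Z F * mink F Y).
  by apply: perpendicular_foot => //; exists F.
have [r vE] : exists r, hvec X + mink X A *: hvec A = r *: pole P Q.
  apply: orthogonal_line => //; rewrite minkDl minkZl.
  - by rewrite (footA X P) //; [ring|exact: hline_l].
  - by rewrite (footA X Q) //; [ring|exact: hline_r].
have r_neq0 : r != 0.
  apply/eqP => r0; have := congr1 (fun v => mink v v) vE.
  rewrite r0 scale0r !minkE !hpoint_norm (minkC A X) => e.
  have := mink_sqr_gt1 XA; move: e; rewrite /mink !mxE; lra.
have FA := mink_lt0 F A.
(* Chosen to make the vector orthogonal to [F]. By [vE] it lies in the span of [X] and [A], where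
   products with points of [m] factor through [F], so it is orthogonal to all of [m]. *)
exists (- mink F (pole P Q) / mink F A) => Y mY.
apply: (mulfI r_neq0); rewrite mulr0 -minkZl scalerDr scalerA -vE.
have -> : mink F (pole P Q) = (mink F X + mink X A * mink F A) / r.
  by apply: (mulfI r_neq0); rewrite -[LHS]minkZr -vE !minkE; field.
rewrite !minkE (footF X Y) // (footF A Y) // (minkC X F) (minkC A F).
by field; rewrite r_neq0 lt_eqF.
Qed.

(** The two equations make the tangential part P + <P,T> T orthogonal to [Q] and [S]; its norm
    <P,T>^2 - 1 is positive, so the coefficient is nonzero. *)
Lemma perpendicular_decomposition P T Q S :
  P <> T -> Q <> S ->
  mink P Q = - (mink P T * mink T Q) -> mink P S = - (mink P T * mink T S) ->
  exists2 s, s != 0 & hvec P = - mink P T *: hvec T + s *: pole Q S.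
Proof.
move=> PT QS rQ rS.
have [s e] : exists s, hvec P + mink P T *: hvec T = s *: pole Q S.
  by apply: orthogonal_line => //; rewrite minkDl minkZl ?rQ ?rS; ring.
have PE : hvec P = - mink P T *: hvec T + s *: pole Q S.
  by rewrite -e scaleNr addrC addrK.
exists s => //; apply/eqP => s0.
have := hpoint_norm P; have := mink_sqr_gt1 PT.
by rewrite PE s0 scale0r addr0 !minkE hpoint_norm; lra.
Qed.

(* [n] is normal to the line through [T] perpendicular to [T P]. The vector
   [s <n, n> T - <P, T> n] is then normal to the perpendicular [P S] of [T P],
   hence lies in the plane of the perpendicular [S V] of [P S], to which [u] is
   normal. *)
Lemma two_sides_further T P S V n u s :
  P <> S -> V <> S -> s != 0 -> mink n T = 0 ->
  hvec P = - mink P T *: hvec T + s *: n ->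
  mink S T = - (mink S P * mink P T) -> mink V P = - (mink V S * mink S P) ->
  mink u V = 0 -> mink u S = 0 ->
  s * mink n n * mink u T = mink P T * mink u n.
Proof.
move=> PS VS s_neq0 nT PE rP rS uV uS.
set k := mink P T in PE rP *; set N := mink n n.
have nP : mink n P = s * N by rewrite PE !minkE nT -/N; ring.
have TP : mink T P = k by exact: minkC.
have norm : s ^+ 2 * N = k ^+ 2 - 1.
  have := hpoint_norm P; rewrite {1}PE minkDl !minkZl nP TP; lra.
have SP : mink S P = - k * mink S T + s * mink S n by rewrite {1}PE !minkE.
have [t nE] : exists t, (s * N) *: hvec T - k *: n = t *: pole P S.
  apply: orthogonal_line => //; rewrite -scaleNr !minkE.
    by rewrite nP TP; ring.
  rewrite (minkC T) (minkC n).
  apply: (mulfI s_neq0).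
  have : mink S T = k ^+ 2 * mink S T - s * k * mink S n.
    by rewrite {1}rP SP; ring.
  have -> : k ^+ 2 = s ^+ 2 * N + 1 by lra.
  by lra.
(* The right angle at [S] makes the direction from [S] to [V] normal to the line [P S]; thus [u],
   orthogonal to [S] and [V], is orthogonal to [pole P S]. *)
have [r vE] : exists r, hvec V + mink V S *: hvec S = r *: pole P S.
  apply: orthogonal_line => //; rewrite !minkE ?hpoint_norm ?rS; last by ring.
  by ring.
have r_neq0 : r != 0.
  apply/eqP => r0; have := congr1 (fun v => mink v v) vE.
  rewrite r0 scale0r !minkE !hpoint_norm (minkC S V) => e.
  have := mink_sqr_gt1 VS; move: e; rewrite /mink !mxE; lra.
have u_pole : mink u (pole P S) = 0.
  by apply: (mulfI r_neq0); rewrite -minkZr -vE !minkE uV uS; ring.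
have := congr1 (mink u) nE; rewrite -scaleNr !minkE u_pole; lra.
Qed.

(** * Reflection exchanging two points of a line *)

(** For A = a Q + b S and C = a' Q + b' S the hypotheses give a : b = b' : a'. The norm and the sign
    of the coordinate sum then force a' = b and b' = a. *)
Lemma reflected_points Q S A C (x y : R) :
  Q <> S -> hline Q S A -> hline Q S C -> x != 0 ->
  x * mink A Q = y * mink A S -> x * mink C S = y * mink C Q ->
  exists r, hvec Q + hvec S = r *: (hvec A + hvec C).
Proof.
move=> QS [a [b AE]] [a' [b' CE]] x_neq0.
have k_lt := mink_lt QS.
rewrite AE CE !minkE !hpoint_norm (minkC S Q); set k := mink Q S in k_lt *.
move=> eA eC.
have eA' : a * (x + y * k) = b * (y + x * k) by lra.
have eC' : b' * (x + y * k) = a' * (y + x * k) by lra.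
have cross : a * a' = b * b'.
  (* The two coefficients cannot both vanish, as [x] is nonzero and k^2 > 1; if the first does, then
     b = a' = 0. *)
  have [e|neq] := eqVneq (x + y * k) 0.
    have neq : y + x * k != 0.
      apply/eqP => e'.
      have : x * (1 - k ^+ 2) = 0.
        have -> : x * (1 - k ^+ 2) = (x + y * k) - k * (y + x * k) by ring.
        by rewrite e e'; ring.
      by move/eqP; rewrite mulf_eq0 (negbTE x_neq0) /= => /eqP; nra.
    move/eqP: eA'; rewrite e mulr0 eq_sym mulf_eq0 (negbTE neq) orbF => /eqP ->.
    move/eqP: eC'; rewrite e mulr0 eq_sym mulf_eq0 (negbTE neq) orbF => /eqP ->.
    by ring.
  apply: (mulIf neq); rewrite mulrAC eA' -[RHS]mulrA eC'; ring.
have nA := hpoint_norm A; rewrite AE !minkE !hpoint_norm (minkC S Q) -/k in nA.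
have nC := hpoint_norm C; rewrite CE !minkE !hpoint_norm (minkC S Q) -/k in nC.
have pos (X : hpoint R) (p q : R) :
    hvec X = p *: hvec Q + q *: hvec S -> 0 < p + q.
  (* The two products add up to (p + q)(k - 1), with k < -1. *)
  move=> XE; have := mink_lt0 X Q; have := mink_lt0 X S.
  rewrite XE !minkE !hpoint_norm (minkC S Q) -/k; nra.
have A_gt0 := pos _ _ _ AE; have C_gt0 := pos _ _ _ CE.
have e1 : a * (a' + b') = (a + b) * b' by lra.
have e2 : b * (a' + b') = (a + b) * a' by lra.
have sumE : a + b = a' + b'.
  apply/eqP; rewrite -(@eqrXn2 _ 2) ?ltW //; apply/eqP.
  transitivity ((a + b) ^+ 2 * (a' ^+ 2 + b' ^+ 2 - 2 * a' * b' * k)).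
    by rewrite (_ : _ - _ = 1) ?mulr1 //; lra.
  transitivity ((a' + b') ^+ 2 * (a ^+ 2 + b ^+ 2 - 2 * a * b * k)).
    transitivity (((a + b) * a') ^+ 2 + ((a + b) * b') ^+ 2
                  - 2 * ((a + b) * a') * ((a + b) * b') * k); first by ring.
    by rewrite -e1 -e2; ring.
  by rewrite (_ : _ - _ = 1) ?mulr1 //; lra.
have e : a' = b by apply: (mulfI (lt0r_neq0 A_gt0)); rewrite -e2 -sumE mulrC.
have e' : b' = a by apply: (mulfI (lt0r_neq0 A_gt0)); rewrite -e1 -sumE mulrC.
exists (a + b)^-1; apply: (scalerI (lt0r_neq0 A_gt0)).
rewrite scalerA divff ?gt_eqF // scale1r.
by rewrite e e' addrACA -!scalerDl [b + a]addrC scalerDr.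
Qed.

End Minkowski.

(** * The right-angled hexagon *)

Theorem theorem9 (R : realType) (A1 A2 B1 B2 D2 D1 : hpoint R)
    (a c : set (hpoint R)) (A C : hpoint R)
    (hexagon : right_angled_hexagon [tuple A1; A2; B1; B2; D2; D1])
    (a_perp : common_perpendicular (hline B2 D2) (hline A1 A2) a)
    (c_perp : common_perpendicular (hline B2 D2) (hline B1 D1) c)
    (A_a : a A) (A_B2D2 : hline B2 D2 A)
    (C_c : c C) (C_B2D2 : hline B2 D2 C) :
  exists M : hpoint R,
    unique (is_midpoint A C) M /\ unique (is_midpoint B2 D2) M.
Proof.
case: hexagon => [[_ inj _] angle].
pose i k (lt : (k < 6)%N) : 'I_6 := Ordinal lt.
have A12 : A1 <> A2 by move=> e; have := inj (i 0 isT) (i 1 isT) e.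
have A2B1 : A2 <> B1 by move=> e; have := inj (i 1 isT) (i 2 isT) e.
have B12 : B1 <> B2 by move=> e; have := inj (i 2 isT) (i 3 isT) e.
have BD2 : B2 <> D2 by move=> e; have := inj (i 3 isT) (i 4 isT) e.
have D12 : D1 <> D2 by move=> e; have := inj (i 5 isT) (i 4 isT) e.
have A1D1 : A1 <> D1 by move=> e; have := inj (i 0 isT) (i 5 isT) e.
have rA1 : mink D1 A2 = - (mink D1 A1 * mink A1 A2).
  exact/right_angle/(angle (i 0 isT)).
have rA2 : mink A1 B1 = - (mink A1 A2 * mink A2 B1).
  exact/right_angle/(angle (i 1 isT)).
have rB1 : mink A2 B2 = - (mink A2 B1 * mink B1 B2).
  exact/right_angle/(angle (i 2 isT)).
have rB2 : mink B1 D2 = - (mink B1 B2 * mink B2 D2).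
  exact/right_angle/(angle (i 3 isT)).
have rD2 : mink B2 D1 = - (mink B2 D2 * mink D2 D1).
  exact/right_angle/(angle (i 4 isT)).
have rD1 : mink D2 A1 = - (mink D2 D1 * mink D1 A1).
  exact/right_angle/(angle (i 5 isT)).
set n := pole B2 D2; have N_gt0 := pole_norm_gt0 BD2; rewrite -/n in N_gt0.
have nB : mink n B2 = 0 by exact: pole_orthol.
have nD : mink n D2 = 0 by exact: pole_orthor.
have nline X : hline B2 D2 X -> mink n X = 0.
  by move=> [p [q ->]]; rewrite !minkE nB nD; ring.
have nA := nline A A_B2D2; have nC := nline C C_B2D2.
have [p p_neq0 B1E] : exists2 s, s != 0 &
    hvec B1 = - mink B1 B2 *: hvec B2 + s *: n.
  apply: perpendicular_decomposition => //; rewrite hpoint_norm; ring.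
have [q q_neq0 D1E] : exists2 s, s != 0 &
    hvec D1 = - mink D1 D2 *: hvec D2 + s *: n.
  apply: perpendicular_decomposition => //; last by rewrite hpoint_norm; ring.
  by rewrite minkC rD2 (minkC B2 D2) (minkC D2 D1); ring.
have [ra a_pole] := common_perpendicular_pole BD2 a_perp A_a A_B2D2.
have [rc c_pole] := common_perpendicular_pole BD2 c_perp C_c C_B2D2.
rewrite -/n in a_pole c_pole.
have uA1 := a_pole _ (hline_l A1 A2); have uA2 := a_pole _ (hline_r A1 A2).
have uB1 := c_pole _ (hline_l B1 D1); have uD1 := c_pole _ (hline_r B1 D1).
have k1 := mink_lt0 B1 B2; have k2 := mink_lt0 D1 D2.
(* Walk along B2, B1, A2, A1, using the right angles at B1 and A2; [aD] walks the other way, along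
   D2, D1, A1, A2. *)
have aB : p * ra * mink A B2 = mink B1 B2.
  have := two_sides_further (nesym A2B1) A12 p_neq0 nB B1E rB1 rA2 uA1 uA2.
  rewrite !minkE nB (minkC A n) nA mulr0 addr0 add0r => e.
  by apply: (mulfI (lt0r_neq0 N_gt0)); lra.
have aD : q * ra * mink A D2 = mink D1 D2.
  have rD1' : mink A1 D2 = - (mink A1 D1 * mink D1 D2).
    by rewrite minkC rD1 (minkC D2 D1) (minkC D1 A1); ring.
  have rA1' : mink A2 D1 = - (mink A2 A1 * mink A1 D1).
    by rewrite minkC rA1 (minkC D1 A1) (minkC A1 A2); ring.
  have := two_sides_further (nesym A1D1) (nesym A12) q_neq0 nD D1E rD1' rA1'
            uA2 uA1.
  rewrite !minkE nD (minkC A n) nA mulr0 addr0 add0r => e.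
  by apply: (mulfI (lt0r_neq0 N_gt0)); lra.
(* The product of [B1E] with the normal n + rc C of the line B1D1. *)
have cB : p * mink n n = rc * mink B1 B2 * mink C B2.
  by move: uB1; rewrite {1}B1E !minkE nB (minkC C n) nC -/n; lra.
have cD : q * mink n n = rc * mink D1 D2 * mink C D2.
  by move: uD1; rewrite {1}D1E !minkE nD (minkC C n) nC -/n; lra.
have ra_neq0 : ra != 0 by apply/eqP => e; move: aB; rewrite e; lra.
have rc_neq0 : rc != 0.
  apply/eqP => e; move/eqP: cB; rewrite e !mul0r mulf_eq0 (negbTE p_neq0).
  by rewrite gt_eqF.
have [r BDE] : exists r, hvec B2 + hvec D2 = r *: (hvec A + hvec C).
  (* These weights cross-multiply [aB] with [aD] and [cB] with [cD], up to the nonzero factors [ra]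
     and [rc]. *)
  apply: (@reflected_points _ _ _ _ _ (p * mink D1 D2) (q * mink B1 B2)) => //.
  - by rewrite mulf_neq0 // lt_eqF.
  - apply: (mulfI ra_neq0).
    transitivity (mink D1 D2 * (p * ra * mink A B2)); first by ring.
    by rewrite aB -{1}aD; ring.
  - apply: (mulfI rc_neq0).
    transitivity (p * (rc * mink D1 D2 * mink C D2)); first by ring.
    rewrite -cD; transitivity (q * (p * mink n n)); first by ring.
    by rewrite cB; ring.
have [M [s ME]] := midpoint_exists B2 D2.
exists M; split; last exact: midpoint_unique ME.
by apply: (@midpoint_unique _ _ _ _ (s * r)); rewrite -scalerA -BDE.
Qed.
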